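(* Let $A$ be a real symmetric $n\times n$ matrix and $i\in[n]$. If $A(i)$ is nonsingular, then $A$ has the $i$-SNIP.
   Context: $A(i)$ is $A$ with row and column $i$ deleted. $A$ has the $i$-SNIP if $X=O$ is the only real symmetric matrix $X$ with $A\circ X=O$, $I\circ X=O$ ($\circ$ the entrywise product) and $(AX)(i,:]=O$, where $(AX)(i,:]$ is $AX$ with row $i$ deleted. *)

(* Defs.v *)
From HB Require Import structures.
From mathcomp Require Import all_boot all_order all_algebra.
From mathcomp Require Import reals.
Set Implicit Arguments.
Unset Strict Implicit.
Unset Printing Implicit Defensive.
Import GRing.Theory.
Local Open Scope ring_scope.

Definition sym_mx (R : realType) (n : nat) (A : 'M[R]_n) : Prop := A^T = A.

Definition hadamard (R : realType) (m n : nat) (A B : 'M[R]_(m, n)) :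
  'M[R]_(m, n) := map2_mx *%R A B.

Definition del_mx (R : realType) (n : nat) (A : 'M[R]_n) (i : 'I_n) :
  'M[R]_(n.-1) := row' i (col' i A).

Definition SNIP (R : realType) (n : nat) (i : 'I_n) (A : 'M[R]_n) : Prop :=
  forall X : 'M[R]_n,
    sym_mx X ->
    hadamard A X = 0 ->
    hadamard 1%:M X = 0 ->
    row' i (A *m X) = 0 ->
    X = 0.

(* Main.v *)
Require Import Defs.
From HB Require Import structures.
From mathcomp Require Import all_boot all_order all_algebra.
From mathcomp Require Import reals.
Set Implicit Arguments.
Unset Strict Implicit.
Unset Printing Implicit Defensive.
Import GRing.Theory.
Local Open Scope ring_scope.

(** Column [i] of [X] has a zero [i]-th entry, so the rows other than [i] of
    [A X] say that [A(i)] kills the rest of that column; hence it vanishes.  By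
    symmetry row [i] of [X] vanishes, and the same argument kills all of [X]. *)

(** In each entry of [A *m X] the summand at index [i] vanishes; the indices left are those
    enumerated by [lift i]. *)
Lemma row'_mulmx_row0 (R : realType) (n p : nat) (A : 'M[R]_n) (i : 'I_n)
    (X : 'M[R]_(n, p)) :
  row i X = 0 -> row' i (A *m X) = del_mx A i *m row' i X.
Proof.
case: n A i X => [|n] A i X Xi0; first by case: i {Xi0}.
apply/matrixP => j k; rewrite !mxE (bigD1_ord i) //=.
have -> : X i k = 0 by move/rowP/(_ k): Xi0; rewrite !mxE.
by rewrite mulr0 add0r; apply: eq_bigr => l _; rewrite !mxE.
Qed.

Lemma row0_row'_eq0 (R : realType) (n p : nat) (i : 'I_n) (X : 'M[R]_(n, p)) :
  row i X = 0 -> row' i X = 0 -> X = 0.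
Proof.
move=> /rowP Xi0 /matrixP Xi'0; apply/matrixP => j k.
case: (unliftP i j) => [l ->|->].
  by have := Xi'0 l k; rewrite !mxE.
by have := Xi0 k; rewrite !mxE.
Qed.

(** The width [p] is free so that this applies both to the single column [col i X] and to [X]
    itself. *)
Lemma del_unitmx_inj (R : realType) (n p : nat) (A : 'M[R]_n) (i : 'I_n)
    (X : 'M[R]_(n, p)) :
  del_mx A i \in unitmx -> row i X = 0 -> row' i (A *m X) = 0 -> X = 0.
Proof.
move=> uAi Xi0; rewrite row'_mulmx_row0 // => AX0.
by apply: (row0_row'_eq0 Xi0); rewrite -(mulKmx uAi (row' i X)) AX0 mulmx0.
Qed.

Theorem proposition3p4 (R : realType) (n : nat) (A : 'M[R]_n) (i : 'I_n)
  (hA : sym_mx A) (hAi : del_mx A i \in unitmx) :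
  SNIP i A.
Proof.
move=> X symX _ diagX0 AX0.
have Xii0 : X i i = 0.
  by move/matrixP/(_ i i): diagX0; rewrite !mxE eqxx mul1r.
have colX0 : col i X = 0.
  apply: (del_unitmx_inj hAi); first by apply/matrixP => j k; rewrite !mxE.
  (* Taking column [i] is right multiplication by a basis vector, so it commutes with left
     multiplication by [A]. *)
  rewrite colE mulmxA -colE.
  by apply/matrixP => j k; move/matrixP/(_ j i): AX0; rewrite !mxE.
by apply: (del_unitmx_inj hAi _ AX0); rewrite -symX -tr_col colX0 trmx0.
Qed.
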